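(* Let $A=((a_\ell,r_\ell))_{\ell=0}^\infty$ be an abstract Swiss cheese with $\delta_1(A)>0$. Then there exists a semiclassical abstract Swiss cheese $B$ with $X_B\subseteq X_A$ and $\delta_1(B)\geq \delta_1(A)$.
   Context: Notation: $\mathbb{R}^+$ denotes the set of non-negative real numbers, $\mathbb{N}$ the set of positive integers, and $\mathbb{N}_0$ the set of non-negative integers. For $a\in\mathbb{C}$ and $r>0$, $\mathrm{B}(a,r)$ is the open disk in $\mathbb{C}$ with centre $a$ and radius $r$, and $\bar{\mathrm{B}}(a,r)$ is the corresponding closed disk; also $\mathrm{B}(a,0)=\emptyset$ and $\bar{\mathrm{B}}(a,0)=\{a\}$. An abstract Swiss cheese is a sequence $A=((a_n,r_n))_{n=0}^\infty\in(\mathbb{C}\times\mathbb{R}^+)^{\mathbb{N}_0}$. Its significant index set is $S_A:=\{n\in\mathbb{N}: r_n>0\}$. Its associated Swiss cheese set is $$X_A:=\bar{\mathrm{B}}(a_0,r_0)\setminus\bigcup_{n=1}^\infty \mathrm{B}(a_n,r_n).$$ Its discrepancy (of order $1$) is $$\delta_1(A):=r_0-\sum_{n=1}^\infty r_n\in[-\infty,\infty).$$ The abstract Swiss cheese $A$ is semiclassical if $\sum_{n=1}^\infty r_n<\infty$, $r_0>0$, and for all $k\in S_A$ the following hold: (a) $\mathrm{B}(a_k,r_k)\subseteq \mathrm{B}(a_0,r_0)$; (b) whenever $\ell\in S_A$ has $\ell\neq k$, we have $\mathrm{B}(a_k,r_k)\cap \mathrm{B}(a_\ell,r_\ell)=\emptyset$.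 *)

(* Defs.v *)
(* MathComp-Analysis, with the complex numbers of mathcomp-real-closed. *)
From mathcomp Require Import all_boot all_order all_algebra.
From mathcomp Require Import all_classical all_reals all_analysis.
From mathcomp.real_closed Require Import complex.

Set Implicit Arguments.
Unset Strict Implicit.
Unset Printing Implicit Defensive.

Import Order.TTheory GRing.Theory Num.Theory.

Local Open Scope classical_set_scope.
Local Open Scope ring_scope.
Local Open Scope complex_scope.

Section SwissCheese.
Context {R : realType}.

Definition open_disk (a : R[i]) (r : R) : set R[i] :=
  ball_ Num.norm a r%:C.

(* [closed_ball_] is the set of z with |a - z| <= r, so that radius 0 gives
   the singleton {a}; the library's [closed_ball], the closure of the open
   ball, would give the empty set. *)
Definition closed_disk (a : R[i]) (r : R) : set R[i] :=
  closed_ball_ Num.norm a r%:C.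

Definition abstract_swiss_cheese : Type := nat -> R[i] * {nonneg R}.

Implicit Type A : abstract_swiss_cheese.

Definition center A (n : nat) : R[i] := (A n).1.

Definition radius A (n : nat) : R := (A n).2%:num.

Definition significant_index_set A : set nat :=
  [set n | (0 < n)%N /\ 0 < radius A n].

Definition swiss_cheese_set A : set R[i] :=
  closed_disk (center A 0) (radius A 0) `\`
  \bigcup_(n in [set n | (0 < n)%N]) open_disk (center A n) (radius A n).

Definition radius_sum A : \bar R := (\sum_(1 <= n <oo) (radius A n)%:E)%E.

Definition discrepancy A : \bar R := ((radius A 0)%:E - radius_sum A)%E.

Definition semiclassical A : Prop :=
  [/\ (radius_sum A < +oo)%E,
      0 < radius A 0 &
      forall k, significant_index_set A k ->
        open_disk (center A k) (radius A k) `<=`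
          open_disk (center A 0) (radius A 0) /\
        (forall l, significant_index_set A l -> l <> k ->
          open_disk (center A k) (radius A k) `&`
            open_disk (center A l) (radius A l) = set0)].

End SwissCheese.

Arguments abstract_swiss_cheese R : clear implicits.

(* Main.v *)
From Pilot Require Import Defs.
From mathcomp Require Import all_boot all_order all_algebra.
From mathcomp Require Import all_classical all_reals all_analysis.
From mathcomp.real_closed Require Import complex.
From mathcomp Require Import ring lra.

Set Implicit Arguments.
Unset Strict Implicit.
Unset Printing Implicit Defensive.

Import Order.TTheory GRing.Theory Num.Theory.
Import numFieldNormedType.Exports.
Import Pilot.Defs.

Local Open Scope classical_set_scope.
Local Open Scope ring_scope.
Local Open Scope complex_scope.

(** Finitely many disks can be made disjoint by two moves. If two of them
    overlap, a disk of radius the sum of the two radii, centred at a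
    suitable weighted mean of the two centres, contains both and replaces
    them. If a disk of radius [r] sticks out of the outer disk of radius
    [R], there is a closed disk of radius [R - r] inside the outer disk that
    misses it, got by moving the centre of the outer disk away from the
    offending disk. Neither move changes the outer radius minus the sum of
    the other radii, neither enlarges the Swiss cheese set, and each lowers
    the number of nonempty deleted disks, so for every [N] the procedure
    stops on the first [N] disks of [A] ([exists_separated]).

    For infinitely many disks, pass to a limit of these finite solutions
    along a nonprincipal ultrafilter on the indices [N] ([exists_limit]).
    The radii stay bounded, as do the centres of disks that do not shrink to
    points, and all relevant conditions are weak inequalities between
    distances and radii: a disk lies in another one, misses the outer disk,
    or two disks are disjoint. So they survive in the limit, and so does the
    lower bound on each finite partial discrepancy. The danger is that the
    disk covering the [k]-th disk of [A] escapes to infinity in the list. It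
    cannot, because a merged disk is stored at the smaller of the two
    indices: the [k]-th disk, unless it misses the outer disk, lies in one
    of the first [k] disks of the new family, and the ultrafilter selects
    one index among these finitely many. *)

(** * Real distances in the complex plane *)

Section Distance.
Context {R : realType}.
Implicit Types (z w v : R[i]) (t r : R).

Definition dist z w : R := ComplexField.Normc.normc (z - w).

Lemma distE z w : dist z w =
  Num.sqrt ((complex.Re z - complex.Re w) ^+ 2 +
            (complex.Im z - complex.Im w) ^+ 2).
Proof. by case: z w => [a b] [c d]. Qed.

Lemma normE_dist z w : `|z - w| = (dist z w)%:C.
Proof. by []. Qed.

Lemma dist_ge0 z w : 0 <= dist z w.
Proof. by rewrite -lecR -normE_dist normr_ge0. Qed.

Lemma distC z w : dist z w = dist w z.
Proof. by apply: complexI; rewrite -!normE_dist distrC. Qed.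

Lemma distzz z : dist z z = 0.
Proof. by apply: complexI; rewrite -normE_dist subrr normr0. Qed.

Lemma dist_triangle v z w : dist z w <= dist z v + dist v w.
Proof. by rewrite -lecR rmorphD /= -!normE_dist ler_distD. Qed.

Lemma norm_realC t : `|t%:C| = `|t|%:C.
Proof. by rewrite normc_def /= expr0n /= addr0 sqrtr_sqr. Qed.

Definition line z w t : R[i] := z + t%:C * (w - z).

Lemma dist_linel z w t : dist z (line z w t) = `|t| * dist z w.
Proof.
apply: complexI; rewrite rmorphM /= -norm_realC -!normE_dist /line.
by rewrite opprD addNKr normrN normrM [in RHS]distrC.
Qed.

Lemma dist_liner z w t : dist w (line z w t) = `|1 - t| * dist z w.
Proof.
apply: complexI; rewrite rmorphM /= -norm_realC -!normE_dist /line.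
rewrite [in RHS]distrC -normrM rmorphB /= rmorph1; congr `|_|; ring.
Qed.

Lemma open_diskE a r z : open_disk a r z <-> dist a z < r.
Proof. by rewrite /open_disk /ball_ /= normE_dist ltcR. Qed.

Lemma closed_diskE a r z : closed_disk a r z <-> dist a z <= r.
Proof. by rewrite /closed_disk /closed_ball_ /= normE_dist lecR. Qed.

End Distance.

(** * Limits along an ultrafilter on the natural numbers *)

Section Ultralimits.
Context {R : realType} (U : set_system nat) (UU : UltraFilter U).

Lemma ultra_fmap T (f : nat -> T) : UltraFilter (f @ U).
Proof.
split=> [|G GF UG]; first exact: fmap_proper_filter.
rewrite eqEsubset; split=> // A GA.
have [//|UnA] := in_ultra_setVsetC (f @^-1` A) UU.
by have [y []] := filter_ex (filterI GA (UG (~` A) UnA)).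
Qed.

Lemma bounded_ultralimit (u : nat -> R) (M : R) :
  (\forall n \near U, `|u n| <= M) -> exists x : R, u @ U --> x.
Proof.
move=> uM; have := @segment_compact R (- M) M.
rewrite compact_ultra => /(_ _ (ultra_fmap u)) [|x [_ ux]]; last by exists x.
by near=> n; rewrite /= in_itv /= -ler_norml; near: n.
Unshelve. all: by end_near. Qed.

(** An ultrafilter containing a finite union contains one of the sets; this
    is what fixes the index of the disk that swallows a given disk. *)
Lemma ultra_exists_ord (k : nat) (P : 'I_k -> nat -> Prop) :
  (\forall n \near U, exists i, P i n) ->
  exists i, \forall n \near U, P i n.
Proof.
move=> UP; apply: contrapT => /forallNP noi.
have /filter_forall : forall i, \forall n \near U, ~ P i n.
  by move=> i; have [//|//] := in_ultra_setVsetC (P i) UU => /noi.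
move=> UN.
by have [n [[i Pin] /(_ i)]] := filter_ex (filterI UP UN).
Qed.

(** Convergence of complex sequences, coordinatewise so that only the topology
    of the reals is involved. *)
Definition cvgC (b : nat -> R[i]) (z : R[i]) :=
  (fun n => complex.Re (b n)) @ U --> (complex.Re z : R) /\
  (fun n => complex.Im (b n)) @ U --> (complex.Im z : R).

Lemma cvgC_cst z : cvgC (fun=> z) z.
Proof. by split; exact: cvg_cst. Qed.

Lemma cvg_dist (b c : nat -> R[i]) z w : cvgC b z -> cvgC c w ->
  (fun n => dist (b n) (c n)) @ U --> dist z w.
Proof.
move=> [bzr bzi] [cwr cwi].
under eq_cvg do rewrite distE.
rewrite distE; apply: (continuous_cvg _ (@sqrt_continuous R _)).
by apply: cvgD; under eq_cvg do rewrite expr2;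
  rewrite expr2; apply: cvgM; apply: cvgB.
Qed.

Lemma bounded_cvgC (b : nat -> R[i]) z (M : R) :
  (\forall n \near U, dist (b n) z <= M) -> exists w, cvgC b w.
Proof.
move=> bM.
have coord (f : R[i] -> R) : (forall v, `|f v - f z| <= dist v z) ->
    exists x : R, (fun n => f (b n)) @ U --> x.
  move=> fz; apply: (@bounded_ultralimit _ (M + `|f z|)).
  near=> n; rewrite -[f (b n)](subrK (f z)).
  apply: (le_trans (ler_normD _ _)); rewrite lerD2r.
  by apply: (le_trans (fz _)); near: n.
have [|x bx] := coord (@complex.Re R).
  move=> v; rewrite distE -sqrtr_sqr ler_sqrt ?addr_ge0 ?sqr_ge0//.
  by rewrite lerDl sqr_ge0.
have [|y by_] := coord (@complex.Im R).
  move=> v; rewrite distE -sqrtr_sqr ler_sqrt ?addr_ge0 ?sqr_ge0//.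
  by rewrite lerDr sqr_ge0.
by exists (x +i* y).
Unshelve. all: by end_near. Qed.

End Ultralimits.

(** * Finitely many disks *)

Section FiniteReduction.
Context {R : realType}.
Implicit Types (a b c : nat -> R[i]) (r s t : nat -> R).

Definition upd T (f : nat -> T) k x n := if n == k then x else f n.

Lemma updE T (f : nat -> T) k x : upd f k x k = x.
Proof. by rewrite /upd eqxx. Qed.

Lemma upd_neq T (f : nat -> T) k x n : n != k -> upd f k x n = f n.
Proof. by rewrite /upd => /negPf ->. Qed.

Lemma sum_upd r k x N : (0 < k <= N)%N ->
  \sum_(1 <= n < N.+1) upd r k x n = \sum_(1 <= n < N.+1) r n - r k + x.
Proof.
move=> kN; have kin : k \in index_iota 1 N.+1 by rewrite mem_index_iota ltnS.
rewrite !(bigD1_seq k) ?iota_uniq//= updE.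
rewrite (eq_bigr r) => [|n nk]; last by rewrite upd_neq.
by ring.
Qed.

Lemma sum_upd0 r x N :
  \sum_(1 <= n < N.+1) upd r 0 x n = \sum_(1 <= n < N.+1) r n.
Proof. by apply: eq_big_nat => n /andP[n0 _]; rewrite upd_neq// -lt0n. Qed.

(** The discrepancy of the finite Swiss cheese made of the disks 0 to [N]. *)
Definition slack N r : R := r 0 - \sum_(1 <= n < N.+1) r n.

(** The family of disks [(b, s)] deletes at least what the first [N] disks of
    [(a, r)] delete.  The bound [l <= k] on the index of the covering disk is
    what keeps it under control when [N] tends to infinity. *)
Definition covers N a r b s : Prop :=
  dist (a 0) (b 0) + s 0 <= r 0 /\
  forall k, (0 < k <= N)%N -> 0 < r k ->
    (exists2 l, (0 < l <= k)%N & dist (a k) (b l) + r k <= s l) \/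
    s 0 + r k <= dist (a k) (b 0).

Definition refines N a r b s : Prop :=
  covers N a r b s /\ slack N r <= slack N s.

Lemma refines_refl N a r : refines N a r a r.
Proof.
split; last exact: lexx.
split=> [|k /andP[k0 _] _]; first by rewrite distzz add0r.
by left; exists k; rewrite ?k0 ?leqnn// distzz add0r.
Qed.

Lemma refines_trans N a r b s c t :
  refines N a r b s -> refines N b s c t -> refines N a r c t.
Proof.
move=> [[ab0 abk] rs] [[bc0 bck] st]; split; last exact: le_trans st.
split; first by have := dist_triangle (b 0) (a 0) (c 0); lra.
move=> k kN rk; have [[l /andP[l0 lk] kl]|k0] := abk k kN rk; last first.
  by right; have := dist_triangle (c 0) (a k) (b 0);
     rewrite (distC (c 0)); lra.
have sl : 0 < s l by have := dist_ge0 (a k) (b l); lra.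
have lN : (0 < l <= N)%N.
  by rewrite l0 (leq_trans lk)//; case/andP: kN.
have [[m /andP[m0 ml] lm]|l0'] := bck l lN sl.
  left; exists m; first by rewrite m0 (leq_trans ml).
  by have := dist_triangle (b l) (a k) (c m); lra.
right; have := dist_triangle (a k) (b l) (c 0).
by rewrite (distC (b l) (a k)); lra.
Qed.

(** The merged disk has radius [s l + s m] and its centre divides the segment
    between the old centres in the ratio [s m : s l]; since that segment has
    length at most [s l + s m], the centre moves by at most [s m] from [b l]
    and by at most [s l] from [b m].  It is stored at the smaller index. *)
Lemma refines_merge N b s l m : (0 < l < m)%N -> (m <= N)%N ->
  0 < s l -> 0 < s m -> dist (b l) (b m) <= s l + s m ->
  refines N b s (upd b l (line (b l) (b m) (s m / (s l + s m))))
                (upd (upd s m 0) l (s l + s m)).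
Proof.
move=> /andP[l0 lm] mN sl sm d.
have m0 := ltn_trans l0 lm.
have lN : (l <= N)%N by rewrite (leq_trans (ltnW lm)).
have Sl : 0 < s l + s m by rewrite addr_gt0.
have ratio u : 0 < u -> u / (s l + s m) * dist (b l) (b m) <= u.
  by move=> u0; rewrite mulrAC ler_pdivrMr// ler_wpM2l// ltW.
have neq0 k : (0 < k)%N -> 0%N != k by case: k.
split; first split.
- by rewrite !upd_neq ?neq0// distzz add0r.
- move=> k /andP[k0 kN] sk; left.
  have [->{k k0 kN sk}|kl] := eqVneq k l.
    exists l; first by rewrite l0 leqnn.
    rewrite !updE dist_linel ger0_norm ?divr_ge0 ?(ltW sm) ?(ltW Sl)//.
    by have := ratio _ sm; lra.
  have [->{k k0 kN sk kl}|km] := eqVneq k m.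
    exists l; first by rewrite l0 ltnW.
    have -> : upd b l (line (b l) (b m) (s m / (s l + s m))) l =
              line (b l) (b m) (s m / (s l + s m)) by rewrite updE.
    rewrite updE dist_liner lerD2r.
    have -> : 1 - s m / (s l + s m) = s l / (s l + s m).
      by field; rewrite gt_eqF.
    by rewrite ger0_norm ?divr_ge0 ?(ltW sl) ?(ltW Sl)// ratio.
  by exists k; rewrite ?k0 ?leqnn// !upd_neq// distzz add0r.
- rewrite /slack !sum_upd ?l0 ?m0// !upd_neq ?neq0 ?(ltn_eqF lm)//.
  lra.
Qed.

(** Moving the outer centre by [s k] straight away from [b k] and lowering the
    outer radius by [s k] keeps the new outer disk inside the old one, and
    puts its centre at distance [dist (b 0) (b k) + s k > s 0] from [b k],
    which makes it miss the disk [k]. *)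
Lemma refines_shrink N b s k : (0 < k <= N)%N ->
  0 < s k -> s k < s 0 -> s 0 < dist (b 0) (b k) + s k ->
  refines N b s (upd b 0 (line (b 0) (b k) (- (s k / dist (b 0) (b k)))))
                (upd (upd s k 0) 0 (s 0 - s k)).
Proof.
move=> /andP[k0 kN] sk sk0 d.
have d0 : 0 < dist (b 0) (b k) by lra.
split; first split.
- rewrite !updE dist_linel normrN ger0_norm ?divr_ge0 ?dist_ge0 ?(ltW sk)//.
  by rewrite divfK ?gt_eqF//; lra.
- move=> n /andP[n0 nN] sn; have [->{n n0 nN sn}|nk] := eqVneq n k.
    right; rewrite !updE dist_liner opprK.
    rewrite ger0_norm ?addr_ge0 ?divr_ge0 ?dist_ge0 ?(ltW sk)//.
    by rewrite mulrDl mul1r divfK ?gt_eqF//; lra.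
  left; exists n; first by rewrite n0 leqnn.
  by rewrite !upd_neq -?lt0n// distzz add0r.
- rewrite /slack updE.
  by rewrite sum_upd0 sum_upd ?k0//; lra.
Qed.

(** Containment and disjointness of the nonempty disks, as weak inequalities
    so that they pass to limits. *)
Definition separated N b s : Prop :=
  forall k, (0 < k <= N)%N -> 0 < s k ->
    dist (b 0) (b k) + s k <= s 0 /\
    forall l, (0 < l <= N)%N -> 0 < s l -> l <> k ->
      s k + s l <= dist (b k) (b l).

Definition support N s : {set 'I_N.+1} :=
  [set n : 'I_N.+1 | (0 < n)%N & 0 < s n].

Lemma support_proper N s t m : (0 < m <= N)%N -> 0 < s m -> t m = 0 ->
  (forall n, (0 < n)%N -> 0 < t n -> 0 < s n) ->
  (#|support N t| < #|support N s|)%N.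
Proof.
move=> /andP[m0 mN] sm tm ts; apply/proper_card/properP; split.
  apply/fintype.subsetP => n; rewrite !inE => /andP[n0 tn].
  by rewrite n0 ts.
exists (Ordinal (mN : (m < N.+1)%N)); rewrite inE /= ?m0 ?sm//.
by rewrite tm ltxx andbF.
Qed.

Lemma radius_lt_outer N s k : (forall n, 0 <= s n) -> 0 < slack N s ->
  (0 < k <= N)%N -> s k < s 0.
Proof.
move=> s0 ss kN.
have kin : k \in index_iota 1 N.+1 by rewrite mem_index_iota ltnS.
move: ss; rewrite /slack (bigD1_seq k) ?iota_uniq//= subr_gt0.
by apply: le_lt_trans; rewrite lerDl sumr_ge0.
Qed.

Lemma slack_antitone M N s : (forall n, 0 <= s n) -> (M <= N)%N ->
  slack N s <= slack M s.
Proof.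
move=> s0 MN; rewrite /slack lerD2l lerN2 [leRHS](big_cat_nat (n := M.+1))//=.
by rewrite lerDl sumr_ge0.
Qed.

(** Induction on the number of nonempty disks: a family that is not separated
    admits one of the two moves. *)
Lemma exists_separated N a r : (forall n, 0 <= r n) -> 0 < slack N r ->
  exists b s, [/\ forall n, 0 <= s n, refines N a r b s & separated N b s].
Proof.
have [p] := ubnP #|support N r|; elim: p a r => // p IH a r rp r0 rs.
have reduce b s : (forall n, 0 <= s n) -> refines N a r b s ->
    (#|support N s| < #|support N r|)%N ->
    exists b s, [/\ forall n, 0 <= s n, refines N a r b s & separated N b s].
  move=> s0 ab lt; have [_ srs] := ab.
  have [||c [t [t0 bc ct]]] := IH b s _ s0.
  - exact: leq_trans lt _.
  - exact: lt_le_trans srs.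
  by exists c, t; split=> //; exact: refines_trans bc.
have [sep|] := pselect (separated N a r).
  by exists a, r; split=> //; exact: refines_refl.
case/existsNP=> k /not_implyP[kN /not_implyP[rk /not_andP[out|]]].
  have rk0 := radius_lt_outer r0 rs kN.
  have /andP[k0 _] := kN.
  apply: reduce (refines_shrink kN rk rk0 _) _.
  - by move=> n; rewrite /upd; do 2?[case: ifP => _] => //; rewrite subr_ge0 ltW.
  - by rewrite ltNge; apply/negP.
  - apply: (support_proper kN rk); first by rewrite upd_neq ?updE// -lt0n.
    move=> n n0; rewrite upd_neq -?lt0n// /upd.
    by case: ifP => // _; rewrite ltxx.
case/existsNP=> l /not_implyP[lN /not_implyP[rl /not_implyP[lk near]]].
wlog lt_lk : k l kN rk lN rl lk near / (l < k)%N.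
  move=> W; have [lt|gt|/lk//] := ltngtP l k; first exact: W lt.
  by apply: W gt => //; [move/esym|rewrite distC addrC].
have /andP[l0 _] := lN; have /andP[k0 kleN] := kN.
apply: reduce (refines_merge _ kleN rl rk _) _.
- move=> n; rewrite /upd; do 2?[case: ifP => _] => //.
  by rewrite addr_ge0.
- by rewrite l0.
- by rewrite distC addrC ltW// ltNge; apply/negP.
- apply: (support_proper kN rk); first by rewrite upd_neq ?updE ?gtn_eqF.
  move=> n n0; rewrite /upd; case: ifP => [/eqP ->//|_].
  by case: ifP => // _; rewrite ltxx.
Qed.

End FiniteReduction.

(** * Passage to infinitely many disks *)

(** Ultralimit of the finite reductions.  The centres of a disk whose radius
    tends to 0 may have no limit, but every condition that mentions such a
    centre is void for that disk. *)
Lemma exists_limit {R : realType} (a : nat -> R[i]) (r : nat -> R) (S : R) :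
  (forall n, 0 <= r n) -> S < r 0 ->
  (forall N, \sum_(1 <= n < N.+1) r n <= S) ->
  exists b s,
    [/\ forall n, 0 <= s n, forall N, covers N a r b s,
        forall N, separated N b s & forall N, r 0 - S <= slack N s].
Proof.
move=> r_ge0 S_lt sum_le.
have slack_r N : r 0 - S <= slack N r by rewrite lerD2l lerN2.
have slack_gt0 N : 0 < slack N r.
  by apply: lt_le_trans (slack_r N); rewrite subr_gt0.
have /choice[F HF] : forall N, exists F : (nat -> R[i]) * (nat -> R),
    [/\ forall n, 0 <= F.2 n, refines N a r F.1 F.2 & separated N F.1 F.2].
  move=> N; have [b [s ?]] := exists_separated a r_ge0 (slack_gt0 N).
  by exists (b, s).
pose b l N := (F N).1 l; pose s l N := (F N).2 l.
have s_ge0 l N : 0 <= s l N by have [/(_ l)] := HF N.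
have outer N : dist (a 0) (b 0 N) + s 0 N <= r 0.
  by case: (HF N) => _ [[]].
have slack_s N : r 0 - S <= slack N (F N).2.
  by case: (HF N) => _ [_ /(le_trans (slack_r N))].
have s_le0 l N : (l <= N)%N -> s l N <= s 0 N.
  case: l => // l lN; apply/ltW/(@radius_lt_outer _ N (F N).2) => //.
    by move=> n; exact: s_ge0.
  by apply: lt_le_trans (slack_s N); rewrite subr_gt0.
have [U [UU ooU]] := ultraFilterLemma eventually_filter.
have evU k (P : nat -> Prop) :
    (forall N, (k <= N)%N -> P N) -> \forall N \near U, P N.
  by move=> kP; apply: ooU; exists k.
have /choice[z Hz] : forall l, exists z : R[i] * R,
    s l @ U --> z.2 /\ (0 < z.2 -> cvgC U (b l) z.1).
  move=> l; have [|x sx] := bounded_ultralimit UU (u := s l) (M := r 0).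
    apply: (evU l) => N lN; rewrite ger0_norm// (le_trans (s_le0 l N lN))//.
    by apply: le_trans (outer N); rewrite lerDr dist_ge0.
  (* Only a deleted disk of positive radius is known to lie in the outer disk, which
     bounds its centre. *)
  have [x0|nx0] := pselect (0 < x); last by exists (0, x).
  have [|w bw] := bounded_cvgC UU (b := b l) (z := a 0) (M := r 0 + r 0).
    apply: filterS2 _ _ (evU l _ (fun N => id)) (cvgr_gt x sx _ x0).
    move=> N lN sl; have /le_trans -> // : dist (b l N) (a 0) <=
        dist (a 0) (b 0 N) + dist (b 0 N) (b l N).
      by rewrite addrC ![dist _ (b 0 N)]distC [dist (b 0 N) _]distC dist_triangle.
    have := outer N; have := s_ge0 0 N; have := dist_ge0 (a 0) (b 0 N).
    have : dist (b 0 N) (b l N) <= s 0 N.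
      case: (l) lN sl => [|i] iN si; first by rewrite distzz.
      have [_ _ /(_ i.+1 iN si)[+ _]] := HF N.
      by rewrite -/(s i.+1 N) -/(s 0 N) -/(b i.+1 N) -/(b 0 N); lra.
    lra.
  by exists (w, x).
pose B l := (z l).1; pose t l := (z l).2.
have st l : s l @ U --> t l by case: (Hz l).
have bB l : 0 < t l -> cvgC U (b l) (B l) by case: (Hz l).
have ev_pos l : 0 < t l -> \forall N \near U, 0 < s l N.
  by move=> tl; exact: cvgr_gt (st l) _ tl.
have t_ge0 l : 0 <= t l.
  by apply: (cvgr_to_ge (st l)); apply: (evU 0) => N _; exact: s_ge0.
have t0 : 0 < t 0.
  apply: (@lt_le_trans _ _ (r 0 - S)); first by rewrite subr_gt0.
  apply: (cvgr_to_ge (st 0)).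
  apply: (evU 0) => N _; apply: le_trans (slack_s N) _.
  by rewrite /slack lerBlDr lerDl sumr_ge0// => n _; exact: s_ge0.
exists B, t; split=> // N.
- split.
    apply: (ler_cvg_to (cvgD (cvg_dist UU (cvgC_cst UU (a 0)) (bB 0 t0)) (st 0))
      (cvg_cst (r 0))).
    by apply: (evU 0) => M _; exact: outer.
  move=> k /andP[k0 _] rk.
  have [Q|Q] := in_ultra_setVsetC
    [set N | s 0 N + r k <= dist (a k) (b 0 N)] UU.
    right; exact: ler_cvg_to (cvgD (st 0) (cvg_cst _))
      (cvg_dist UU (cvgC_cst UU _) (bB 0 t0)) Q.
  left; have [|[l lk] Pl] := @ultra_exists_ord U UU k.+1
    (fun l N => (0 < l)%N /\ dist (a k) (b l N) + r k <= s l N).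
    apply: filterS2 _ _ (evU k _ (fun N => id)) Q => M kM nQ.
    have [_ [[_ /(_ k)]]] := HF M; rewrite k0 kM => /(_ isT rk)[|//] [l].
    by move=> /andP[l0 lk] Pl _ _; exists (Ordinal (lk : (l < k.+1)%N)).
  have [_ [/= l0 _]] := filter_ex Pl.
  have Pl' : \forall M \near U, dist (a k) (b l M) + r k <= s l M.
    by apply: filterS Pl => M [].
  (* The limiting radius dominates [r k], so the centres converge too. *)
  have tl : 0 < t l.
    apply: lt_le_trans rk _; apply: (cvgr_to_ge (st l)).
    by apply: filterS Pl' => M; apply: le_trans; rewrite lerDr dist_ge0.
  exists l; first by rewrite l0 -ltnS.
  exact: ler_cvg_to (cvgD (cvg_dist UU (cvgC_cst UU _) (bB l tl)) (cvg_cst _))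
    (st l) Pl'.
- move=> k /andP[k0 _] tk; split=> [|l /andP[l0 _] tl lk].
    apply: (ler_cvg_to (cvgD (cvg_dist UU (bB 0 t0) (bB k tk)) (st k)) (st 0)).
    apply: filterS2 _ _ (evU k _ (fun N => id)) (ev_pos k tk) => M kM sk.
    by have [_ _ /(_ k)] := HF M; rewrite k0 kM => /(_ isT sk)[].
  apply: (ler_cvg_to (cvgD (st k) (st l)) (cvg_dist UU (bB k tk) (bB l tl))).
  apply: filterS3 _ _ (evU (maxn k l) _ (fun N => id)) (ev_pos k tk) (ev_pos l tl).
  move=> M; rewrite geq_max => /andP[kM lM] sk sl.
  have [_ _ /(_ k)] := HF M; rewrite k0 kM => /(_ isT sk)[_ /(_ l)].
  by rewrite l0 lM => /(_ isT sl lk).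
- (* For [M >= N] the slack of the [M]-th reduction over its first [N] disks is
     at least its full slack. *)
  have : (fun M => slack N (F M).2) @ U --> slack N t.
    apply: cvgB; first exact: st.
    by apply: cvg_big => [|n _]; [exact: add_continuous|exact: st].
  move=> /cvgr_to_ge; apply; apply: (evU N) => M NM.
  apply: le_trans (slack_s M) _; apply: slack_antitone => // n; exact: s_ge0.
Qed.

(** * Swiss cheeses *)

Section Cheese.
Context {R : realType}.

Definition cheese (b : nat -> R[i]) (s : nat -> R) (s_ge0 : forall n, 0 <= s n) :
  abstract_swiss_cheese R := fun n => (b n, NngNum (s_ge0 n)).

Lemma radius_ge0 (A : abstract_swiss_cheese R) n : 0 <= radius A n.
Proof. by rewrite /radius. Qed.

Lemma radius_sum_leP (A : abstract_swiss_cheese R) (S : R) :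
  (radius_sum A <= S%:E)%E <->
  forall N, \sum_(1 <= n < N.+1) radius A n <= S.
Proof.
have A0 n : (0 <= (radius A n)%:E)%E by rewrite lee_fin radius_ge0.
split=> [AS N|AS].
  rewrite -lee_fin -sumEFin; apply: le_trans AS.
  exact: nneseries_lim_ge.
apply: lime_le; first exact: is_cvg_nneseries.
apply: nearW => -[|n]; rewrite sumEFin lee_fin; last exact: AS.
by have := AS 0; rewrite !big_geq.
Qed.

Lemma discrepancy_geP (A : abstract_swiss_cheese R) (d : R) :
  (d%:E <= discrepancy A)%E <-> forall N, d <= slack N (radius A).
Proof.
have -> : (d%:E <= discrepancy A)%E = (radius_sum A <= (radius A 0 - d)%:E)%E.
  rewrite /discrepancy; case: (radius_sum A) => [x| |].
  - by rewrite -EFinB !lee_fin lerBrDr addrC -lerBrDr.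
  - by rewrite leye_eq.
  - by rewrite /= leey leNye.
split=> [/radius_sum_leP dA N|dA]; last apply/radius_sum_leP => N.
  by have := dA N; rewrite /slack; lra.
by have := dA N; rewrite /slack; lra.
Qed.

Lemma covers_swiss_cheese_set (A B : abstract_swiss_cheese R) :
  (forall N, covers N (center A) (radius A) (center B) (radius B)) ->
  swiss_cheese_set B `<=` swiss_cheese_set A.
Proof.
move=> AB z [/closed_diskE Bz Bdisks]; split.
  apply/closed_diskE; have [AB0 _] := AB 0.
  by have := dist_triangle (center B 0) (center A 0) z; lra.
move=> [k /= k0 /open_diskE kz].
have rk : 0 < radius A k by apply: le_lt_trans kz; exact: dist_ge0.
have [_ /(_ k)] := AB k; rewrite k0 leqnn => /(_ isT rk)[[l /andP[l0 _] kl]|out].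
  apply: Bdisks; exists l => //; apply/open_diskE.
  have := dist_triangle (center A k) (center B l) z.
  by rewrite (distC (center B l) (center A k)); lra.
have := dist_triangle z (center A k) (center B 0).
by rewrite (distC z); lra.
Qed.

Lemma separated_semiclassical (A : abstract_swiss_cheese R) :
  (radius_sum A < +oo)%E -> 0 < radius A 0 ->
  (forall N, separated N (center A) (radius A)) -> semiclassical A.
Proof.
move=> Aoo A0 sep; split=> // k [k0 rk]; split=> [z /open_diskE kz|l [l0 rl] lk].
  apply/open_diskE; have [] := sep k k _ rk; first by rewrite k0 leqnn.
  by have := dist_triangle (center A k) (center A 0) z; lra.
rewrite -subset0 => z [/open_diskE kz /open_diskE lz].
have [|_ /(_ l)] := sep (maxn k l) k _ rk; first by rewrite k0 leq_maxl.
rewrite l0 leq_maxr => /(_ isT rl lk).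
by have := dist_triangle z (center A k) (center A l); rewrite (distC z); lra.
Qed.

End Cheese.

Theorem theorem7p3 (R : realType) (A : abstract_swiss_cheese R)
    (hA : (0 < discrepancy A)%E) :
  exists B : abstract_swiss_cheese R,
    semiclassical B /\
    (swiss_cheese_set B `<=` swiss_cheese_set A)%classic /\
    (discrepancy A <= discrepancy B)%E.
Proof.
have sum0 (C : abstract_swiss_cheese R) : (0 <= radius_sum C)%E.
  by apply: nneseries_ge0 => n _ _; rewrite lee_fin radius_ge0.
have [d dA] : exists d : R, discrepancy A = d%:E.
  exists (fine (discrepancy A)); rewrite fineK// fin_numElt.
  rewrite (lt_trans _ hA)//=; apply: le_lt_trans (ltry (radius A 0)).
  by rewrite /discrepancy geeDl// oppe_le0.
rewrite dA in hA *; rewrite lte_fin in hA.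
have /discrepancy_geP slackA : (d%:E <= discrepancy A)%E by rewrite dA.
have [|||b [s [s0 cov sep sl]]] :=
    @exists_limit R (center A) (radius A) (radius A 0 - d).
- exact: radius_ge0.
- by rewrite gtrBl.
- by move=> N; have := slackA N; rewrite /slack; lra.
pose B := cheese b s0.
have slackB N : d <= slack N (radius B).
  by have := sl N; rewrite opprB addrC subrK.
have dB : (d%:E <= discrepancy B)%E by exact/discrepancy_geP.
exists B; split; last by split=> //; exact: covers_swiss_cheese_set.
apply: separated_semiclassical => //.
  rewrite ltey; apply/eqP => Boo; move: dB.
  by rewrite /discrepancy Boo.
apply: lt_le_trans hA _; have := slackB 0.
by rewrite /slack big_geq// subr0.
Qed.
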